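(* Let $\kappa,\varepsilon,h,\tau>0$, let $u_h^0\in\mathcal{A}_h$, and let $(u_h^k)_{k=0,1,\dots}\subset V_h^3$ be the iterates defined as follows: given $u_h^k$, set $u_h^{k+1}=u_h^k+\tau\,d_tu_h^{k+1}$, where $d_tu_h^{k+1}\in\mathcal{F}_h[u_h^k]$ is the solution of $$(d_tu_h^{k+1},v_h)_\star+\kappa\big([u_h^k]''+\tau[d_tu_h^{k+1}]'',v_h''\big)+\varepsilon^{-1}\big(u_h^k+\tau d_tu_h^{k+1},G_Dv_h\big)_h=-(2\varepsilon)^{-1}\big(\nabla V_D^{\rm cv}(u_h^k),v_h\big)_h$$ for all $v_h\in\mathcal{F}_h[u_h^k]$. Then for all $K\ge0$, $$E_{h,\varepsilon}[u_h^K]+\tau\sum_{k=0}^{K-1}\|d_tu_h^{k+1}\|_\star^2\le E_{h,\varepsilon}[u_h^0],$$ and, provided that $\|v'\|_{L^\infty(I)}\le c_\star\|v\|_\star$ for all $v\in V_h^3$, for all $K\ge 0$, $$\big\|\mathcal{I}_{1,h}|[u_h^K]'|^2-1\big\|_{L^\infty(I)}\le c_\star^2\,\tau\,E_{h,\varepsilon}[u_h^0].$$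
   Context: $I\subset\mathbb{R}$ is a bounded interval; $(\cdot,\cdot)$ is the $L^2(I;\mathbb{R}^3)$ inner product; $(\cdot,\cdot)_\star$ is an inner product on $L^2(I;\mathbb{R}^3)$ with induced norm $\|\cdot\|_\star$. Confinement: $D=\bigcap_{r=1}^R D_r\subset\mathbb{R}^3$ with $D_r=\{y\in\mathbb{R}^3:|y|_{D_r}^2=y\cdot G_{D_r}y\le1\}$, $G_{D_r}\in\mathbb{R}^{3\times3}$ symmetric positive semi-definite, $|y|_{D_r}=(y\cdot G_{D_r}y)^{1/2}$. For each $r$ let $V_{D_r}^{\rm cv}(y)=-|y|_{D_r}^2$ if $y\in D_r$ and $V_{D_r}^{\rm cv}(y)=-2|y|_{D_r}+1$ otherwise; this is a $C^1$ concave function, and $V_{D_r}(y):=\frac12(|y|_{D_r}-1)_+^2=\frac12|y|_{D_r}^2+\frac12V_{D_r}^{\rm cv}(y)$. Put $G_D=\sum_{r=1}^RG_{D_r}$, $V_D^{\rm cv}=\sum_{r=1}^RV_{D_r}^{\rm cv}$ and $V_D=\sum_{r=1}^RV_{D_r}$, so $V_D(y)=\frac12\,y\cdot G_Dy+\frac12V_D^{\rm cv}(y)$ (the case $R=1$ is a simple quadratic confinement). Boundary conditions: $L_{\rm bc}:H^2(I;\mathbb{R}^3)\to\mathbb{R}^\ell$ is a bounded linear operator and $\ell_{\rm bc}\in\mathbb{R}^\ell$ is fixed. Discretization: $\mathcal{P}_h$ is a partition of $I$ with nodes $x_0<x_1<\dots<x_N$ ($x_0,x_N$ the endpoints of $I$)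 and maximal subinterval length $h$. $V_h\subset H^2(I)$ is the space of globally continuously differentiable functions that are cubic polynomials on each subinterval. $\mathcal{I}_{1,h}$ is the nodal interpolation operator into globally continuous functions that are affine on each subinterval, and $(v,w)_h=\int_I\mathcal{I}_{1,h}(v\cdot w)\,\mathrm{d}x$. Further, $\mathcal{A}_h=\{u_h\in V_h^3:|u_h'(x_i)|^2=1,\ i=0,\dots,N,\ L_{\rm bc}[u_h]=\ell_{\rm bc}\}$ and, for $u_h\in V_h^3$, $\mathcal{F}_h[u_h]=\{v_h\in V_h^3:u_h'(x_i)\cdot v_h'(x_i)=0,\ i=0,\dots,N,\ L_{\rm bc}[v_h]=0\}$. Energy: for all $u_h\in V_h^3$ (whether or not $u_h\in\mathcal{A}_h$), $$E_{h,\varepsilon}[u_h]=\frac{\kappa}{2}\int_I|u_h''|^2\,\mathrm{d}x+\frac{1}{2\varepsilon}\int_I\mathcal{I}_{1,h}\big(u_h\cdot G_Du_h+V_D^{\rm cv}(u_h)\big)\,\mathrm{d}x=\frac{\kappa}{2}\int_I|u_h''|^2\,\mathrm{d}x+\frac1\varepsilon\int_I\mathcal{I}_{1,h}V_D(u_h)\,\mathrm{d}x.$$ *)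

(* Defs.v *)
From HB Require Import structures.
From mathcomp Require Import all_boot all_order all_algebra.
From mathcomp Require Import all_classical all_reals all_analysis.
From mathcomp Require Import ring lra.

Set Implicit Arguments.
Unset Strict Implicit.
Unset Printing Implicit Defensive.

Import Order.TTheory GRing.Theory Num.Theory.
Import numFieldNormedType.Exports.

Local Open Scope classical_set_scope.
Local Open Scope ring_scope.

(* The bounded interval I is represented by `[a, b] with a < b.  Elements of
   L^2(I), H^2(I), V_h are represented by total functions on R; every notion
   below depends only on the values on `[a, b], and the notions attached to
   L^2(I) and H^2(I) only on the values almost everywhere on `[a, b]. *)

Section Vectors.
Context {R : realType}.

Definition dot n (u v : 'cV[R]_n) : R := \sum_(i < n) u i 0 * v i 0.

(* The norm of the library on matrices is the sup norm. *)
Definition enorm n (u : 'cV[R]_n) : R := Num.sqrt (dot u u).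

Definition sym_psd n (G : 'M[R]_n) : Prop :=
  G^T = G /\ forall y : 'cV[R]_n, 0 <= dot y (G *m y).

Definition gradient n (f : 'cV[R]_n.+1 -> R) (y : 'cV[R]_n.+1) : 'cV[R]_n.+1 :=
  \col_i 'D_(delta_mx i 0) f y.

End Vectors.

Section Confinement.
Context {R : realType}.

Definition cnorm n (G : 'M[R]_n) (y : 'cV[R]_n) : R :=
  Num.sqrt (dot y (G *m y)).

Definition Dset n (G : 'M[R]_n) : set 'cV[R]_n := [set y | cnorm G y ^+ 2 <= 1].

Definition Vcv1 n (G : 'M[R]_n) (y : 'cV[R]_n) : R :=
  if y \in Dset G then - cnorm G y ^+ 2 else - 2 * cnorm G y + 1.

Definition Vconf1 n (G : 'M[R]_n) (y : 'cV[R]_n) : R :=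
  2^-1 * Num.max (cnorm G y - 1) 0 ^+ 2.

Lemma Vconf1E n (G : 'M[R]_n) (y : 'cV[R]_n) :
  Vconf1 G y = 2^-1 * cnorm G y ^+ 2 + 2^-1 * Vcv1 G y.
Proof.
have c0 : 0 <= cnorm G y by exact: sqrtr_ge0.
rewrite /Vconf1 /Vcv1; case: ifPn => [|/negP]; rewrite in_setE /Dset /= => h.
  by rewrite max_r ?expr0n/=; [ring|nra].
by rewrite max_l; [field|nra].
Qed.

Definition Gtot n m (G : 'I_m -> 'M[R]_n) : 'M[R]_n := \sum_(r < m) G r.

Definition Vcv n m (G : 'I_m -> 'M[R]_n) (y : 'cV[R]_n) : R :=
  \sum_(r < m) Vcv1 (G r) y.

End Confinement.

Section FunctionSpaces.
Context {R : realType}.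
Variables a b : R.

Local Notation mu := (@lebesgue_measure R).

Definition ae_eqI (u v : R -> 'cV[R]_3) : Prop :=
  {ae mu, forall x, `[a, b]%classic x -> u x = v x}.

Definition L2 (f : R -> R) : Prop :=
  measurable_fun `[a, b] f /\
  mu.-integrable `[a, b] (fun x => (f x ^+ 2)%:E).

Definition L2vec (u : R -> 'cV[R]_3) : Prop := forall i, L2 (fun x => u x i 0).

Definition ip (u v : R -> 'cV[R]_3) : R := \int[mu]_(x in `[a, b]) dot (u x) (v x).

Definition Linfnorm (f : R -> R) : \bar R :=
  Lnorm (mrestr mu (measurable_itv `[a, b])) +oo%E (EFin \o f).

(* star induces an inner product on the quotient L^2(I; R^3). *)
Record L2_inner_product (star : (R -> 'cV[R]_3) -> (R -> 'cV[R]_3) -> R) : Prop :=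
  L2InnerProduct {
    star_ae : forall u v w, L2vec u -> L2vec v -> L2vec w ->
      ae_eqI u v -> star u w = star v w ;
    star_sym : forall u v, L2vec u -> L2vec v -> star u v = star v u ;
    star_lin : forall (c : R) u v w, L2vec u -> L2vec v -> L2vec w ->
      star (fun x => c *: u x + v x) w = c * star u w + star v w ;
    star_ge0 : forall u, L2vec u -> 0 <= star u u ;
    star_def : forall u, L2vec u -> star u u = 0 -> ae_eqI u (cst 0)
  }.

Definition star_norm (star : (R -> 'cV[R]_3) -> (R -> 'cV[R]_3) -> R)
  (u : R -> 'cV[R]_3) : R := Num.sqrt (star u u).

Definition test_function (phi : R -> R) : Prop :=
  (forall n x, derivable (derive1n n phi) x 1) /\
  exists c d : R, [/\ a < c, d < b & forall x, x \notin `[c, d] -> phi x = 0].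

Definition weak_derivative (f g : R -> R) : Prop :=
  forall phi, test_function phi ->
  \int[mu]_(x in `[a, b]) (f x * derive1 phi x) =
  - \int[mu]_(x in `[a, b]) (g x * phi x).

Definition H2_with (u u1 u2 : R -> 'cV[R]_3) : Prop :=
  [/\ L2vec u, L2vec u1, L2vec u2,
      forall i, weak_derivative (fun x => u x i 0) (fun x => u1 x i 0) &
      forall i, weak_derivative (fun x => u1 x i 0) (fun x => u2 x i 0)].

Definition H2 (u : R -> 'cV[R]_3) : Prop := exists u1 u2, H2_with u u1 u2.

(* Linearity and boundedness force L u = L v whenever u = v a.e. on `[a, b]. *)
Definition bounded_linear_H2 l (L : (R -> 'cV[R]_3) -> 'cV[R]_l) : Prop :=
  (forall (c : R) u v, H2 u -> H2 v ->
     L (fun x => c *: u x + v x) = c *: L u + L v) /\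
  exists C : R, forall u u1 u2, H2_with u u1 u2 ->
     enorm (L u) <= C * Num.sqrt (ip u u + ip u1 u1 + ip u2 u2).

(* Derivatives relative to `[a, b], hence one-sided at a and b.  The second
   derivative of a spline need not exist at the nodes, where D1 (D1 f) takes an
   irrelevant value; the nodes form a null set. *)
Definition dquot (f : R -> R) (x y : R) : R := (f y - f x) / (y - x).

Definition derivableI (f : R -> R) (x : R) : Prop :=
  cvg (dquot f x @ within `[a, b] x^').

Definition D1 (f : R -> R) (x : R) : R :=
  lim (dquot f x @ within `[a, b] x^').

Definition vD1 (u : R -> 'cV[R]_3) (x : R) : 'cV[R]_3 :=
  \col_i D1 (fun y => u y i 0) x.

Definition C1 (f : R -> R) : Prop :=
  (forall x, `[a, b]%classic x -> derivableI f x) /\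
  {within `[a, b], continuous (D1 f)}.

End FunctionSpaces.

Section Discretization.
Context {R : realType}.
(* The nodes are a :: s; they form a partition when itv_partition a b s. *)
Variables (a b : R) (s : seq R).

Local Notation mu := (@lebesgue_measure R).

Definition node (i : nat) : R := nth b (a :: s) i.

Definition mesh : R := \big[Num.max/0]_(i < size s) (node i.+1 - node i).

Definition Vh (f : R -> R) : Prop :=
  C1 a b f /\
  forall i, (i < size s)%N -> exists p : {poly R}, (size p <= 4)%N /\
    forall x, x \in `[node i, node i.+1] -> f x = p.[x].

Definition Vh3 (u : R -> 'cV[R]_3) : Prop := forall i, Vh (fun x => u x i 0).

(* Each summand is 0 to the left of its subinterval, affine on it, and constant
   to the right of it; see interp_affine. *)
Definition interp (g : R -> R) (x : R) : R :=
  g a + \sum_(i < size s) (g (node i.+1) - g (node i)) *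
     Num.max 0 (Num.min 1 ((x - node i) / (node i.+1 - node i))).

Lemma node_lt i : itv_partition a b s -> (i < size s)%N -> node i < node i.+1.
Proof.
by move=> [/(pathP b) sp _] /sp.
Qed.

Lemma node_le i j : itv_partition a b s -> (i <= j <= size s)%N ->
  node i <= node j.
Proof.
move=> ps; elim: j => [|j IH] /andP[]; first by rewrite leqn0 => /eqP ->.
rewrite leq_eqVlt => /predU1P[->//|ij] js.
apply: le_trans (ltW (node_lt ps js)); apply: IH.
by rewrite -ltnS ij ltnW.
Qed.

Lemma interp_affine (g : R -> R) (i : nat) (x : R) :
  itv_partition a b s -> (i < size s)%N -> node i <= x <= node i.+1 ->
  interp g x = g (node i) +
    (g (node i.+1) - g (node i)) * ((x - node i) / (node i.+1 - node i)).
Proof.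
move=> ps si /andP[ix xi].
have clamp1 j : (j < i)%N ->
    Num.max 0 (Num.min 1 ((x - node j) / (node j.+1 - node j))) = 1.
  move=> ji; have js := ltn_trans ji si; have d0 := node_lt ps js.
  rewrite min_l ?max_r// ler_pdivlMr ?subr_gt0// mul1r lerD2r.
  by apply: le_trans ix; apply: node_le => //; rewrite ji ltnW.
have clamp0 j : (i < j < size s)%N ->
    Num.max 0 (Num.min 1 ((x - node j) / (node j.+1 - node j))) = 0.
  move=> /andP[ij js]; have d0 := node_lt ps js.
  apply: max_l; rewrite ge_min; apply/orP; right.
  rewrite ler_pdivrMr ?subr_gt0// mul0r subr_le0.
  by apply: (le_trans xi); apply: node_le => //; rewrite ij ltnW.
have d0 := node_lt ps si.
have clampi : Num.max 0 (Num.min 1 ((x - node i) / (node i.+1 - node i))) =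
    (x - node i) / (node i.+1 - node i).
  rewrite min_r ?max_r//; first by rewrite divr_ge0 ?subr_ge0 // ltW.
  by rewrite ler_pdivrMr ?subr_gt0// mul1r lerD2r.
pose F j := (g (node j.+1) - g (node j)) *
  Num.max 0 (Num.min 1 ((x - node j) / (node j.+1 - node j))).
rewrite /interp -(big_mkord xpredT F) (big_cat_nat (n := i)) //=; last exact: ltnW.
rewrite (big_ltn si) {2}/F clampi.
have -> : \sum_(i.+1 <= j < size s) F j = 0.
  by rewrite big_nat_cond; apply: big1 => j /andP[js _]; rewrite /F clamp0// mulr0.
rewrite addr0 addrA; congr (_ + _).
rewrite (@eq_big_nat _ _ _ 0 i _ (fun j => g (node j.+1) - g (node j))).
  by rewrite telescope_sumr// /node/= addrC subrK.
by move=> j /andP[_ ji]; rewrite /F clamp1// mulr1.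
Qed.

Definition iph (u v : R -> 'cV[R]_3) : R :=
  \int[mu]_(x in `[a, b]) interp (fun y => dot (u y) (v y)) x.

Definition Ah l (L : (R -> 'cV[R]_3) -> 'cV[R]_l) (lbc : 'cV[R]_l)
  (u : R -> 'cV[R]_3) : Prop :=
  [/\ Vh3 u,
      forall i, (i <= size s)%N -> enorm (vD1 a b u (node i)) ^+ 2 = 1 &
      L u = lbc].

Definition Fh l (L : (R -> 'cV[R]_3) -> 'cV[R]_l) (u v : R -> 'cV[R]_3) : Prop :=
  [/\ Vh3 v,
      forall i, (i <= size s)%N ->
        dot (vD1 a b u (node i)) (vD1 a b v (node i)) = 0 &
      L v = 0].

Definition energy m (G : 'I_m -> 'M[R]_3) (kappa eps : R) (u : R -> 'cV[R]_3) : R :=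
  kappa / 2 *
    (\int[mu]_(x in `[a, b]) (enorm (vD1 a b (vD1 a b u) x) ^+ 2)) +
  (2 * eps)^-1 *
    (\int[mu]_(x in `[a, b])
       interp (fun y => dot (u y) (Gtot G *m u y) + Vcv G (u y)) x).

End Discretization.

(* Main.v *)
Require Import Defs.
From HB Require Import structures.
From mathcomp Require Import all_boot all_order all_algebra.
From mathcomp Require Import all_classical all_reals all_analysis.
From mathcomp Require Import ess_sup_inf measurable_realfun ring lra.

Set Implicit Arguments.
Unset Strict Implicit.
Unset Printing Implicit Defensive.

Import Order.TTheory GRing.Theory Num.Theory.
Import numFieldNormedType.Exports.

Local Open Scope classical_set_scope.
Local Open Scope ring_scope.

(** The scheme treats the convex quadratic parts of the energy implicitly and
    the concave part of the potential explicitly, and each choice has the right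
    sign.  Test the scheme at step k with v = d := d_t u^{k+1}, which is
    admissible.  Two elementary inequalities turn the result into a decrease
    of the energy by at least tau * |d|_star^2:
    - for the quadratic forms,
      |w|^2 - |u|^2 = 2 tau w . d - tau^2 |d|^2 <= 2 tau w . d, w = u + tau d,
      used for the second derivatives ([bending_step]) and for G_D at the nodes;
    - for the concave part, V(w) <= V(u) + tau grad V(u) . d ([Vcv_concave]).
    The two nodal inequalities form [confinement_step]; they may be integrated
    because nodal interpolation is linear and monotone in the nodal values
    ([lumped_linear], [lumped_le]).  Summing [energy_step] over k gives the
    stability estimate.

    For the constraint, d'(x_i) is orthogonal to u'(x_i), so by Pythagoras
    |u'(x_i)|^2 grows by exactly tau^2 |d'(x_i)|^2 in each step.  This is at
    most tau^2 cstar^2 |d|_star^2, and the stability estimate bounds the sum of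
    these terms, the energy being nonnegative.  An interpolant lies between
    bounds on its nodal values, which gives the bound on the whole interval.

    The analytic work is in the passage between pointwise and almost everywhere
    notions.  The second derivative of a spline is a polynomial on each open
    cell and arbitrary at the nodes; this suffices for integrability
    ([integrable_off_nodes]) and determines integrals
    ([eq_integral_off_nodes]).  In the other direction, an essential bound on
    the continuous function |v'| holds at every point, the nodes included
    ([le_Linfnorm]). *)

(** * Euclidean products and semidefinite forms *)

Section DotProduct.
Context {R : realType} {n : nat}.
Implicit Types (u v w : 'cV[R]_n) (c : R) (G : 'M[R]_n).

Lemma dotE u v : dot u v = (u^T *m v) 0 0.
Proof. by rewrite /dot mxE; apply: eq_bigr => i _; rewrite mxE. Qed.

Lemma dotC u v : dot u v = dot v u.
Proof. by apply: eq_bigr => i _; rewrite mulrC. Qed.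

Lemma dotDr u v w : dot u (v + w) = dot u v + dot u w.
Proof. by rewrite !dotE mulmxDr mxE. Qed.

Lemma dotZr c u v : dot u (c *: v) = c * dot u v.
Proof. by rewrite !dotE -scalemxAr mxE. Qed.

Lemma dotDl u v w : dot (u + v) w = dot u w + dot v w.
Proof. by rewrite dotC dotDr !(dotC w). Qed.

Lemma dotZl c u v : dot (c *: u) v = c * dot u v.
Proof. by rewrite dotC dotZr dotC. Qed.

Lemma dotNr u v : dot u (- v) = - dot u v.
Proof. by rewrite -scaleN1r dotZr mulN1r. Qed.

Lemma dotNl u v : dot (- u) v = - dot u v.
Proof. by rewrite dotC dotNr dotC. Qed.

Lemma dot_suml I r (P : pred I) (F : I -> 'cV[R]_n) v :
  dot (\sum_(i <- r | P i) F i) v = \sum_(i <- r | P i) dot (F i) v.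
Proof.
rewrite dotE linear_sum/= mulmx_suml summxE.
by apply: eq_bigr => i _; rewrite dotE.
Qed.

Lemma dot_delta u i : dot u (delta_mx i 0) = u i 0.
Proof.
rewrite /dot (bigD1 i)//= big1 ?addr0 => [|j ji]; first by rewrite mxE !eqxx mulr1.
by rewrite mxE (negbTE ji) mulr0.
Qed.

Lemma dot_ge0 u : 0 <= dot u u.
Proof. by apply: sumr_ge0 => i _; rewrite -expr2 sqr_ge0. Qed.

Lemma sqr_enorm u : enorm u ^+ 2 = dot u u.
Proof. by rewrite sqr_sqrtr// dot_ge0. Qed.

Lemma dot_sym_mul G u v : G^T = G -> dot u (G *m v) = dot v (G *m u).
Proof. by move=> sG; rewrite dotC !dotE trmx_mul sG mulmxA. Qed.

Lemma sqr_cnorm G u : sym_psd G -> cnorm G u ^+ 2 = dot u (G *m u).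
Proof. by move=> [_ G0]; rewrite sqr_sqrtr. Qed.

Lemma dot_psdD G u v : G^T = G ->
  dot (u + v) (G *m (u + v)) =
  dot u (G *m u) + 2 * dot u (G *m v) + dot v (G *m v).
Proof.
move=> sG; rewrite mulmxDr !dotDr !dotDl (dot_sym_mul v u sG); ring.
Qed.

(** Nonnegativity of the form on s *: u + t *: v for all s and t; where one of the
    seminorms vanishes, a large multiple of that vector rules out a positive product. *)
Lemma cauchy_schwarz_psd G u v : sym_psd G ->
  dot u (G *m v) <= cnorm G u * cnorm G v.
Proof.
move=> psdG; have [sG G0] := psdG.
have q0 s t : 0 <= s ^+ 2 * cnorm G u ^+ 2 + 2 * (s * t) * dot u (G *m v)
    + t ^+ 2 * cnorm G v ^+ 2.
  have := G0 (s *: u + t *: v); rewrite dot_psdD// -!scalemxAr !dotZl !dotZr.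
  by rewrite !sqr_cnorm//; lra.
have A0 : 0 <= cnorm G u by exact: sqrtr_ge0.
have B0 : 0 <= cnorm G v by exact: sqrtr_ge0.
move: q0 A0 B0; set A := cnorm G u; set B := cnorm G v; set c := dot _ _.
move=> q0 A0 B0; rewrite leNgt; apply/negP => ABc.
have c0 : 0 < c by apply: le_lt_trans ABc; rewrite mulr_ge0.
(* With this multiple the form takes the value - (B^2 + 1) + B^2 = - 1; the
   case B = 0 is symmetric. *)
have [A00|An0] := eqVneq A 0.
  have := q0 (- ((B ^+ 2 + 1) / (2 * c))) 1; rewrite A00.
  have -> : 2 * (- ((B ^+ 2 + 1) / (2 * c)) * 1) * c = - (B ^+ 2 + 1).
    by field; rewrite gt_eqF.
  by lra.
have [B00|Bn0] := eqVneq B 0.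
  have := q0 1 (- ((A ^+ 2 + 1) / (2 * c))); rewrite B00.
  have -> : 2 * (1 * - ((A ^+ 2 + 1) / (2 * c))) * c = - (A ^+ 2 + 1).
    by field; rewrite gt_eqF.
  by lra.
have AB0 : 0 < A * B by rewrite mulr_gt0 // lt0r ?An0 ?Bn0.
(* The form is then 2 A B (A B - c). *)
have := q0 B (- A).
have -> : B ^+ 2 * A ^+ 2 + 2 * (B * - A) * c + (- A) ^+ 2 * B ^+ 2
  = 2 * (A * B) * (A * B - c) by ring.
by nra.
Qed.

End DotProduct.

(** * Concavity and gradient of the confinement potential *)

Section Confinement.
Context {R : realType}.

(** The gradient of [Vcv1 G] at y, as [Vcv_concave] shows for the sum: with
    A = |y|_D, the derivatives of - A^2 and of - 2 A + 1 agree at A = 1. *)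
Definition gradV1 n (G : 'M[R]_n) (y : 'cV[R]_n) : 'cV[R]_n :=
  (if cnorm G y <= 1 then - 2 else - 2 / cnorm G y) *: (G *m y).

Lemma Vcv1E n (G : 'M[R]_n) (y : 'cV[R]_n) :
  Vcv1 G y = if cnorm G y <= 1 then - cnorm G y ^+ 2 else - 2 * cnorm G y + 1.
Proof.
have c0 : 0 <= cnorm G y by exact: sqrtr_ge0.
rewrite /Vcv1; congr (if _ then _ else _); rewrite /Dset; apply/idP/idP.
  by rewrite in_setE /= expr_le1.
by move=> ?; rewrite in_setE /= expr_le1.
Qed.

Lemma dot_gradV1 n (G : 'M[R]_n) (y z : 'cV[R]_n) : sym_psd G ->
  dot (gradV1 G y) (z - y) =
  (if cnorm G y <= 1 then - 2 else - 2 / cnorm G y) *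
  (dot y (G *m z) - cnorm G y ^+ 2).
Proof.
move=> psdG; have [sG _] := psdG.
by rewrite dotZl dotC dotDl dotNl sqr_cnorm// (dot_sym_mul z y sG).
Qed.

(** By Cauchy-Schwarz it is enough to compare values of the profile A |-> Vcv1 at
    A = |y|_D and B = |z|_D.  When A and B lie on different sides of 1 the
    inequality reduces to (1 - A) (2 B - 1 - A) >= 0 or to (B - 1)^2 >= 0. *)
Lemma Vcv1_concave n (G : 'M[R]_n) (y z : 'cV[R]_n) : sym_psd G ->
  Vcv1 G z <= Vcv1 G y + dot (gradV1 G y) (z - y).
Proof.
move=> psdG; rewrite dot_gradV1// !Vcv1E.
have := cauchy_schwarz_psd y z psdG.
have A0 : 0 <= cnorm G y by exact: sqrtr_ge0.
have B0 : 0 <= cnorm G z by exact: sqrtr_ge0.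
move: A0 B0; set A := cnorm G y; set B := cnorm G z; set c := dot _ _ => A0 B0 cAB.
case: (leP A 1) => A1.
  case: (leP B 1) => B1; first by have := sqr_ge0 (A - B); lra.
  have : 0 <= (1 - A) * (B - 1) by rewrite mulr_ge0// subr_ge0 // ltW.
  by have := sqr_ge0 (1 - A); lra.
have -> : - 2 * A + 1 + - 2 / A * (c - A ^+ 2) = 1 - 2 * (c / A).
  by field; rewrite gt_eqF//; lra.
have : c / A <= B by rewrite ler_pdivrMr; [rewrite mulrC | lra].
case: (leP B 1) => B1 cA; last by lra.
by have := sqr_ge0 (B - 1); rewrite sqrrB expr1n mulr1; lra.
Qed.

(** Vcv1 + |.|_D^2 = 2 V_D is convex, so Vcv1 lies above its tangent minus the
    square of the seminorm of the increment.  Together with [Vcv1_concave] this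
    encloses Vcv1 so tightly that its gradient can be read off, without
    differentiating the square root. *)
Lemma Vcv1_semiconvex n (G : 'M[R]_n) (y z : 'cV[R]_n) : sym_psd G ->
  Vcv1 G y + dot (gradV1 G y) (z - y) - dot (z - y) (G *m (z - y)) <= Vcv1 G z.
Proof.
move=> psdG; rewrite dot_gradV1// !Vcv1E.
have [sG _] := psdG.
rewrite addrC dot_psdD// mulmxN dotNl !dotNr opprK -!sqr_cnorm//.
rewrite (dot_sym_mul z y sG).
have := cauchy_schwarz_psd y z psdG.
have A0 : 0 <= cnorm G y by exact: sqrtr_ge0.
have B0 : 0 <= cnorm G z by exact: sqrtr_ge0.
move: A0 B0; set A := cnorm G y; set B := cnorm G z; set c := dot _ _ => A0 B0 cAB.
case: (leP A 1) => A1.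
  by case: (leP B 1) => B1; last have := sqr_ge0 (B - 1); lra.
have -> : - (B ^+ 2 + 2 * - c + A ^+ 2) +
  (- 2 * A + 1 + - 2 / A * (c - A ^+ 2)) = 1 - B ^+ 2 - A ^+ 2 + 2 * (c - c / A).
  by field; rewrite gt_eqF//; lra.
have : c - c / A <= A * B - B.
  have -> : c - c / A = c * (1 - A^-1) by field; rewrite gt_eqF//; lra.
  have -> : A * B - B = A * B * (1 - A^-1) by field; rewrite gt_eqF//; lra.
  by apply: ler_wpM2r => //; rewrite subr_ge0 invf_le1 ?ltW//; lra.
case: (leP B 1) => B1 cA; last by have := sqr_ge0 (A - B); lra.
have : 0 <= (A - 1) * (1 - B) by rewrite mulr_ge0// subr_ge0 // ltW.
by have := sqr_ge0 (A - 1); lra.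
Qed.

(** A function enclosed between its affine candidate and a quadratic error has
    difference quotients within |t| times a constant of the candidate slope. *)
Lemma derive_sandwich n (f : 'cV[R]_n.+1 -> R) (g : 'cV[R]_n.+1)
    (M : 'M[R]_n.+1) (y v : 'cV[R]_n.+1) :
  (forall z, f z <= f y + dot g (z - y)) ->
  (forall z, f y + dot g (z - y) - dot (z - y) (M *m (z - y)) <= f z) ->
  'D_v f y = dot g v.
Proof.
move=> up lo; rewrite /derive; apply: cvg_lim => //.
(* The summand 1 only makes C positive, so that e / C can bound |t|. *)
pose C := `|dot v (M *m v)| + 1.
have C0 : 0 < C by rewrite ltr_wpDl.
apply/cvgrPdist_le => e e0; near=> t.
have t0 : t != 0 by near: t; exact: nbhs_dnbhs_neq.
have te : `|t| * C <= e.
  rewrite -ler_pdivlMr//; near: t; apply: dnbhs0_le.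
  exact: divr_gt0.
have := up (t *: v + y); have := lo (t *: v + y).
rewrite addrK -scalemxAr !dotZr dotZl.
set X := f (_ + y); set Y := f y; set d := dot g v; set q := dot v _ => l0 u0.
rewrite /= -/X -/Y.
have -> : d - t^-1 *: (X - Y) = t^-1 * (t * d - (X - Y)).
  by rewrite -[_ *: _]/(_ * _); field.
rewrite normrM normfV; apply: le_trans te.
rewrite mulrC ler_pdivrMr ?normr_gt0//.
have nt : `|t| * `|t| = t * t by rewrite -normrM ger0_norm// -expr2 sqr_ge0.
rewrite mulrAC nt.
have t20 : 0 <= t * t by rewrite -expr2 sqr_ge0.
have hq : `|q| <= C by rewrite /C lerDl.
have := ler_norm q; have := ler_norm (- q); rewrite normrN => q1 q2.
rewrite ler_norml; apply/andP; split; nra.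
Unshelve. all: by end_near. Qed.

Lemma Vcv_concave n m (G : 'I_m -> 'M[R]_n.+1) (y z : 'cV[R]_n.+1) :
  (forall r, sym_psd (G r)) ->
  Vcv G z <= Vcv G y + dot (gradient (Vcv G) y) (z - y).
Proof.
move=> psdG; pose g := \sum_(r < m) gradV1 (G r) y.
have up w : Vcv G w <= Vcv G y + dot g (w - y).
  rewrite /Vcv dot_suml -big_split/=.
  by apply: ler_sum => r _; exact: Vcv1_concave.
have lo w : Vcv G y + dot g (w - y) - dot (w - y) (Gtot G *m (w - y)) <= Vcv G w.
  rewrite /Vcv /Gtot mulmx_suml (dotC _ (\sum_(_ < _) _)) !dot_suml.
  rewrite -big_split/= -sumrB; apply: ler_sum => r _.
  by rewrite (dotC (G r *m _)); exact: Vcv1_semiconvex.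
suff -> : gradient (Vcv G) y = g by [].
by apply/colP => i; rewrite mxE (derive_sandwich _ up lo) dot_delta.
Qed.

Lemma sym_psd_Gtot n m (G : 'I_m -> 'M[R]_n) :
  (forall r, sym_psd (G r)) -> sym_psd (Gtot G).
Proof.
move=> psdG; split=> [|y].
  by rewrite /Gtot linear_sum/=; apply: eq_bigr => r _; case: (psdG r).
rewrite /Gtot mulmx_suml dotC dot_suml; apply: sumr_ge0 => r _.
by rewrite dotC; case: (psdG r) => _; apply.
Qed.

(** The expression is twice the sum of the penalties [Vconf1 (G r) y], each of
    them half a square. *)
Lemma confinement_ge0 n m (G : 'I_m -> 'M[R]_n) (y : 'cV[R]_n) :
  (forall r, sym_psd (G r)) -> 0 <= dot y (Gtot G *m y) + Vcv G y.
Proof.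
move=> psdG.
rewrite /Gtot mulmx_suml dotC dot_suml -big_split/=; apply: sumr_ge0 => r _.
rewrite dotC -sqr_cnorm//; have : 0 <= Vconf1 (G r) y.
  by rewrite mulr_ge0 ?sqr_ge0// invr_ge0.
by rewrite Vconf1E; lra.
Qed.

(** Quadratic part at the new point, concave part at the old one: the discarded
    terms are - t^2 d . G_D d and the concavity defect. *)
Lemma confinement_step n m (G : 'I_m -> 'M[R]_n.+1) (y d : 'cV[R]_n.+1) (t : R) :
  (forall r, sym_psd (G r)) ->
  dot (y + t *: d) (Gtot G *m (y + t *: d)) + Vcv G (y + t *: d) <=
  dot y (Gtot G *m y) + Vcv G y +
  2 * t * dot (y + t *: d) (Gtot G *m d) + t * dot (gradient (Vcv G) y) d.
Proof.
move=> psdG; have [sG G0] := sym_psd_Gtot psdG.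
have := Vcv_concave y (y + t *: d) psdG.
rewrite (addrC y) addrK dotZr addrC dot_psdD// -!scalemxAr !dotZr !dotZl dotDl dotZl.
have : 0 <= t ^+ 2 * dot d (Gtot G *m d) by rewrite mulr_ge0// sqr_ge0.
lra.
Qed.

End Confinement.

(** * Derivatives relative to an interval *)

Section RelativeDerivative.
Context {R : realType}.
Variables a b : R.
Hypothesis ab : a < b.
Implicit Types (f g : R -> R) (p : {poly R}).

Lemma within_dnbhs_proper (x : R) : x \in `[a, b] ->
  ProperFilter (within `[a, b] x^').
Proof.
rewrite in_itv/= => /andP[ax xb]; split; last exact: within_filter.
move=> [e /= e0 /= he].
have [xltb|bx] := ltP x b.
  pose y := Num.min b (x + e / 2).
  have xy : x < y by rewrite lt_min xltb ltrDl divr_gt0.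
  have ye : y <= x + e / 2 by rewrite ge_min lexx orbT.
  apply: (he y).
  - by rewrite /ball_/= distrC ger0_norm; [lra|rewrite subr_ge0 ltW].
  - by rewrite gt_eqF.
  - by rewrite /= in_itv/= ge_min lexx andbT (le_trans ax (ltW xy)).
pose y := Num.max a (x - e / 2).
have yx : y < x.
  by rewrite gt_max (lt_le_trans ab bx)/= ltrBlDr ltrDl divr_gt0.
have ye : x - e / 2 <= y by rewrite le_max lexx orbT.
apply: (he y).
- by rewrite /ball_/= ger0_norm; [lra|rewrite subr_ge0 ltW].
- by rewrite lt_eqF.
- by rewrite /= in_itv/= le_max lexx/= (le_trans (ltW yx) xb).
Qed.

Lemma within_dnbhs_id (x : R) : id @ within `[a, b] x^' --> x.
Proof. by apply: cvg_trans (@nbhs_dnbhs _ x); exact: cvg_within. Qed.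

Lemma near_within_dnbhs (P : R -> Prop) (x : R) :
  (\forall y \near x, y \in `[a, b] -> y != x -> P y) ->
  \forall y \near within `[a, b] x^', P y.
Proof.
move=> h; rewrite !near_withinE; apply: filterS h => y h yx yab.
exact: h.
Qed.

Lemma near_within_dnbhsT (P : R -> Prop) (x : R) :
  (forall y, y \in `[a, b] -> y != x -> P y) ->
  \forall y \near within `[a, b] x^', P y.
Proof. by move=> h; rewrite !near_withinE; near=> y => yx yab; exact: h.
Unshelve. all: by end_near. Qed.

Lemma D1_unique f x c : x \in `[a, b] ->
  dquot f x @ within `[a, b] x^' --> c -> D1 a b f x = c.
Proof.
by move=> xab fc; apply: cvg_lim => //; exact: within_dnbhs_proper.
Qed.

Lemma dquot_cvg_eq f g (x c : R) : x \in `[a, b] ->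
  f x = g x ->
  (\forall y \near x, y \in `[a, b] -> f y = g y) ->
  dquot f x @ within `[a, b] x^' --> c ->
  dquot g x @ within `[a, b] x^' --> c.
Proof.
move=> xab fgx fg; apply: cvg_trans; apply: near_eq_cvg.
apply: near_within_dnbhs => //; apply: filterS fg => y fgy yab _.
by rewrite /dquot fgx fgy.
Qed.

(** Agreement of w with the combination on the interval alone is enough, as the
    quotients defining D1 only involve points of the interval. *)
Lemma D1_linear f g w (c : R) x : x \in `[a, b] ->
  (forall y, y \in `[a, b] -> w y = f y + c * g y) ->
  derivableI a b f x -> derivableI a b g x ->
  D1 a b w x = D1 a b f x + c * D1 a b g x.
Proof.
move=> xab wE df dg; apply: D1_unique => //.
pose q y := dquot f x y + c * dquot g x y.
have qc : q y @[y --> within `[a, b] x^'] --> D1 a b f x + c * D1 a b g x.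
  have := within_dnbhs_proper xab => PF.
  by apply: cvgD; [exact: df | apply: cvgMr; exact: dg].
apply: cvg_trans qc; apply: near_eq_cvg; apply: near_within_dnbhsT => y yab _.
by rewrite /q /dquot !wE//; ring.
Qed.

(** The difference quotient of p at x is the polynomial q with
    p - p(x) = q ('X - x), whose value at x is the derivative of p. *)
Lemma dquot_horner_cvg p x : x \in `[a, b] ->
  dquot (horner p) x @ within `[a, b] x^' --> p^`().[x].
Proof.
move=> xab.
have /factor_theorem [q pq] : root (p - p.[x]%:P) x.
  by rewrite rootE !hornerE subrr.
have pE : p = q * ('X - x%:P) + p.[x]%:P by rewrite -pq subrK.
have -> : p^`().[x] = q.[x].
  by rewrite {1}pE derivD derivM derivXsubC derivC !hornerE subrr mulr0 add0r.
have : q.[y] @[y --> within `[a, b] x^'] --> q.[x].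
  exact: (@cvg_comp _ _ _ id (horner q) _ _ _
    (within_dnbhs_id (x:=x)) (@continuous_horner _ q x)).
apply: cvg_trans; apply: near_eq_cvg.
apply: near_within_dnbhsT => y yab yx.
rewrite /dquot {1}pE !hornerE -{1}/(p.[y]); field.
by rewrite subr_eq0.
Qed.

(** Openness of the cell makes it irrelevant what f does elsewhere. *)
Lemma D1_poly_open f p (c d : R) : a <= c -> d <= b ->
  (forall x, x \in `]c, d[ -> f x = p.[x]) ->
  forall x, x \in `]c, d[ -> D1 a b f x = p^`().[x].
Proof.
move=> ac db fp x xcd.
have xab : x \in `[a, b].
  by move: xcd; rewrite !in_itv/= => /andP[? ?]; apply/andP; split; lra.
apply: D1_unique => //.
apply: (@dquot_cvg_eq (horner p) f x _ xab _ _ (dquot_horner_cvg (p:=p) xab)).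
  by rewrite fp.
near=> y => _; rewrite fp//; near: y.
exact: near_in_itvoo.
Unshelve. all: by end_near. Qed.

Lemma derivableI_continuous f :
  (forall x, x \in `[a, b] -> derivableI a b f x) ->
  {within `[a, b], continuous f}.
Proof.
move=> df; apply/subspace_continuousP => x /= xab.
have := within_dnbhs_proper xab => PF.
have fx : f y @[y --> within `[a, b] x^'] --> f x.
  have h : f x + dquot f x y * (y - x) @[y --> within `[a, b] x^'] -->
      f x + D1 a b f x * (x - x).
    apply: cvgD; first exact: cvg_cst.
    apply: cvgM; first exact: df.
    apply: cvgB; last exact: cvg_cst.
    exact: within_dnbhs_id.
  move: h; rewrite subrr mulr0 addr0; apply: cvg_trans; apply: near_eq_cvg.
  apply: near_within_dnbhsT => y yab yx.
  by rewrite /dquot; field; rewrite subr_eq0.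
apply/cvgrPdist_le => e e0; move/cvgrPdist_le : fx => /(_ _ e0).
rewrite !near_withinE; apply: filterS => y hy yab.
have [->|yx] := eqVneq y x; first by rewrite subrr normr0 ltW.
exact: hy.
Qed.

End RelativeDerivative.

(** * Functions that are polynomial on the open cells of a partition *)

Lemma integrableU d (T : measurableType d) (R : realType)
    (mu : {measure set T -> \bar R}) (A B : set T) (f : T -> \bar R) :
  measurable A -> measurable B ->
  mu.-integrable A f -> mu.-integrable B f -> mu.-integrable (A `|` B) f.
Proof.
move=> mA mB fA fB.
have mBA : measurable (B `\` A) by exact: measurableD.
have fBA : mu.-integrable (B `\` A) f by apply: integrableS fB => // x [].
have mAB := measurableU _ _ mA mB.
apply: (proj2 (integrable_mkcond f mAB)).
have {}fA := proj1 (integrable_mkcond f mA) fA.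
have {}fBA := proj1 (integrable_mkcond f mBA) fBA.
have := integrableD measurableT fA fBA; apply: eq_integrable => // x _.
rewrite /= !patchE in_setD in_setU.
by case: (x \in A); case: (x \in B); rewrite /= ?adde0 ?add0e.
Qed.

Section Partition.
Context {R : realType}.
Variables (a b : R) (s : seq R).
Hypotheses (ab : a < b) (ps : itv_partition a b s).
Local Notation mu := (@lebesgue_measure R).
Local Notation node := (node a b s).

Lemma node0 : node 0%N = a. Proof. by []. Qed.

Lemma node_last : node (size s) = b.
Proof. exact: itv_partition_nth_size. Qed.

Lemma node_in_itv i : (i <= size s)%N -> node i \in `[a, b].
Proof.
move=> si; rewrite in_itv/=; apply/andP; split.
  by apply: (@node_le _ a b s 0%N) => //; rewrite leq0n.
by rewrite -[leRHS]node_last; apply: node_le => //; rewrite si leqnn.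
Qed.

Lemma node_in i : (i <= size s)%N -> node i \in a :: s.
Proof. by move=> si; rewrite mem_nth. Qed.

Lemma cell_exists (x : R) : x \in `[a, b] ->
  exists2 i, (i < size s)%N & node i <= x <= node i.+1.
Proof.
rewrite in_itv/= => /andP[ax xb].
have s0 : (0 < size s)%N.
  by case: (s) ps => // -[_ /eqP/= abE]; move: ab; rewrite abE ltxx.
have cell k : (0 < k <= size s)%N -> x <= node k ->
    exists2 i, (i < size s)%N & node i <= x <= node i.+1.
  elim: k => [//|k IH] /= ks xk.
  have [xk'|kx] := leP x (node k); last by exists k; rewrite ?(ltW kx).
  case: k IH ks xk xk' => [_|k IH] ks xk xk'; first by exists 0%N; rewrite ?ax.
  by apply: IH => //=; exact: ltnW.
by apply: (cell (size s)); rewrite ?s0 ?leqnn ?node_last.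
Qed.

Lemma cell_sub i : (i < size s)%N -> a <= node i /\ node i.+1 <= b.
Proof.
move=> si; have := node_in_itv (ltnW si); have := node_in_itv si.
by rewrite !in_itv/= => /andP[_ ?] /andP[? _].
Qed.

Lemma cell_open_exists (x : R) : x \in `[a, b] -> x \notin a :: s ->
  exists2 i, (i < size s)%N & x \in `]node i, node i.+1[.
Proof.
move=> /cell_exists[i si /andP[ix xi]] xs; exists i => //.
rewrite in_itv/= !lt_neqAle ix xi !andbT; apply/andP; split.
  by apply: contra xs => /eqP <-; exact/node_in/ltnW.
by apply: contra xs => /eqP ->; exact/node_in.
Qed.

Lemma integrable_horner (c d : R) (p : {poly R}) :
  mu.-integrable `[c, d] (EFin \o horner p).
Proof.
apply: continuous_compact_integrable; first exact: segment_compact.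
by apply: continuous_subspaceT; exact: continuous_horner.
Qed.

(** No condition at the nodes: this is what is known of the second derivative of
    a spline, and it is stable under sums and products. *)
Definition off_nodes_poly (F : R -> R) := forall i, (i < size s)%N ->
  exists p : {poly R}, forall x, x \in `]node i, node i.+1[ -> F x = p.[x].

Lemma off_nodes_polyD F H : off_nodes_poly F -> off_nodes_poly H ->
  off_nodes_poly (fun x => F x + H x).
Proof.
move=> hF hH i si; have [p pE] := hF i si; have [q qE] := hH i si.
by exists (p + q) => x xi; rewrite hornerD pE// qE.
Qed.

Lemma off_nodes_polyM F H : off_nodes_poly F -> off_nodes_poly H ->
  off_nodes_poly (fun x => F x * H x).
Proof.
move=> hF hH i si; have [p pE] := hF i si; have [q qE] := hH i si.
by exists (p * q) => x xi; rewrite hornerM pE// qE.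
Qed.

Lemma off_nodes_polyC (c : R) : off_nodes_poly (cst c).
Proof. by move=> i si; exists c%:P => x _; rewrite hornerC. Qed.

Lemma off_nodes_poly_sum n (F : 'I_n -> R -> R) :
  (forall i, off_nodes_poly (F i)) ->
  off_nodes_poly (fun x => \sum_(i < n) F i x).
Proof.
elim: n F => [|n IH] F hF.
  by move=> i si; exists 0 => x _; rewrite big_ord0 horner0.
have := off_nodes_polyD (IH _ (fun i => hF (widen_ord (leqnSn n) i))) (hF ord_max).
by move=> h i si; have [p pE] := h i si; exists p => x xi; rewrite big_ord_recr/= pE.
Qed.

(** One cell is added at a time: the closed part already treated, the open cell,
    where the function is a polynomial, and the right node, which is a null set. *)
Lemma integrable_off_nodes F : off_nodes_poly F ->
  mu.-integrable `[a, b] (EFin \o F).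
Proof.
move=> hF.
have int1 (x : R) : mu.-integrable [set x] (EFin \o F).
  apply: null_set_integrable => //; last exact: lebesgue_measure_set1.
  exact: measurable_fun_set1.
suff int k : (k <= size s)%N -> mu.-integrable `[a, node k] (EFin \o F).
  by rewrite -node_last; exact: int.
elim: k => [_|k IH ks]; first by rewrite node0 set_itv1.
have [p pE] := hF k ks.
have into : mu.-integrable `]node k, node k.+1[ (EFin \o F).
  have ho : mu.-integrable `]node k, node k.+1[ (EFin \o horner p).
    apply: integrableS (integrable_horner (node k) (node k.+1) p) => //.
    exact: subset_itv_oo_cc.
  by apply: eq_integrable ho => // x; rewrite inE/= => xk; rewrite pE.
have := integrableU _ _ (IH (ltnW ks)) (integrableU _ _ into (int1 (node k.+1))).
have nk := node_lt ps ks.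
rewrite setUitv1 ?bnd_simp// -itv_bndbnd_setU ?bnd_simp//.
- by apply => //; exact: measurableU.
- by have := cell_sub ks; case.
- exact: ltW.
Qed.

(** The nodes are finitely many, hence a null set. *)
Lemma eq_integral_off_nodes F H : off_nodes_poly F -> off_nodes_poly H ->
  (forall i x, (i < size s)%N -> x \in `]node i, node i.+1[ -> F x = H x) ->
  \int[mu]_(x in `[a, b]) F x = \int[mu]_(x in `[a, b]) H x.
Proof.
move=> hF hH FH; rewrite /Rintegral; congr fine; apply: ae_eq_integral => //.
- by have /integrableP[] := integrable_off_nodes hF.
- by have /integrableP[] := integrable_off_nodes hH.
have cs : countable [set` a :: s] by exact: finite_set_countable.
exists [set` a :: s]; split.
- exact: countable_measurable.
- exact: countable_lebesgue_measure0.
move=> x /= h; apply: contrapT => xs; apply: h => xab.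
have [i si xi] := cell_open_exists xab (introN idP xs).
by rewrite (FH i).
Qed.

End Partition.

(** * Nodal interpolation *)

Section Interpolation.
Context {R : realType}.
Variables (a b : R) (s : seq R).
Hypotheses (ab : a < b) (ps : itv_partition a b s).
Local Notation mu := (@lebesgue_measure R).
Local Notation node := (node a b s).
Local Notation interp := (interp a b s).

Lemma interp_linear (f g : R -> R) (c x : R) :
  interp (fun y => f y + c * g y) x = interp f x + c * interp g x.
Proof.
rewrite /interp mulrDr mulr_sumr addrACA -big_split/=; congr (_ + _).
by apply: eq_bigr => i _; ring.
Qed.

Lemma interp_cst (c x : R) : interp (fun=> c) x = c.
Proof. by rewrite /interp big1 ?addr0// => i _; rewrite subrr mul0r. Qed.

(** On a cell the interpolant is a convex combination of two nodal values. *)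
Lemma interp_ge0 (g : R -> R) (x : R) : x \in `[a, b] ->
  (forall i, (i <= size s)%N -> 0 <= g (node i)) -> 0 <= interp g x.
Proof.
move=> xab g0; have [i si xi] := cell_exists ab ps xab.
rewrite (interp_affine _ ps si xi); have d0 := node_lt ps si.
set t := _ / _; have t0 : 0 <= t.
  by case/andP: xi => ? ?; rewrite divr_ge0 ?subr_ge0// ltW.
have t1 : t <= 1.
  by case/andP: xi => ? ?; rewrite ler_pdivrMr ?subr_gt0// mul1r lerD2r.
have := mulr_ge0 (g0 _ (ltnW si)) (_ : 0 <= 1 - t).
rewrite subr_ge0 => /(_ t1); have := mulr_ge0 (g0 _ si) t0; lra.
Qed.

Lemma interp_le (f g : R -> R) (x : R) : x \in `[a, b] ->
  (forall i, (i <= size s)%N -> f (node i) <= g (node i)) ->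
  interp f x <= interp g x.
Proof.
move=> xab fg; rewrite -subr_ge0 -mulN1r -interp_linear.
by apply: interp_ge0 => // i si; rewrite mulN1r subr_ge0 fg.
Qed.

Lemma integrable_interp (g : R -> R) :
  mu.-integrable `[a, b] (EFin \o interp g).
Proof.
apply: continuous_compact_integrable; first exact: segment_compact.
apply: continuous_subspaceT => x; apply: cvgD; first exact: cvg_cst.
apply: cvg_big => [|i _]; first exact: add_continuous.
apply: cvgMr.
apply: (@continuous_max _ _ (cst 0) _ x); first exact: cvg_cst.
apply: (@continuous_min _ _ (cst 1) _ x); first exact: cvg_cst.
by apply: cvgM; [apply: cvgB => //; exact: cvg_cst|exact: cvg_cst].
Qed.

(** The quadrature underlying the discrete product: [iph a b s u v] is the lumped
    integral of the pointwise product [dot (u y) (v y)]. *)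
Definition lumped (g : R -> R) : R := \int[mu]_(x in `[a, b]) interp g x.

Lemma lumped_linear (f g : R -> R) (c : R) :
  lumped (fun y => f y + c * g y) = lumped f + c * lumped g.
Proof.
have -> : lumped (fun y => f y + c * g y) =
    \int[mu]_(x in `[a, b]) (interp f x + c * interp g x).
  by apply: eq_Rintegral => x _; rewrite interp_linear.
have cg : mu.-integrable `[a, b] (EFin \o (fun x => c * interp g x)).
  have : mu.-integrable `[a, b] (fun x => c%:E * (EFin \o interp g) x)%E.
    by apply: integrableZl => //; exact: integrable_interp.
  by apply: eq_integrable => // x _; rewrite /= EFinM.
by rewrite RintegralD ?RintegralZl//; exact: integrable_interp.
Qed.

Lemma lumped_le (f g : R -> R) :
  (forall i, (i <= size s)%N -> f (node i) <= g (node i)) ->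
  lumped f <= lumped g.
Proof.
move=> fg; apply: le_Rintegral => [//|||x /= xab].
- exact: integrable_interp.
- exact: integrable_interp.
- exact: interp_le.
Qed.

Lemma lumped_ge0 (g : R -> R) :
  (forall i, (i <= size s)%N -> 0 <= g (node i)) -> 0 <= lumped g.
Proof. by move=> g0; apply: Rintegral_ge0 => x /= xab; exact: interp_ge0. Qed.

End Interpolation.

(** * Second derivatives of splines and the bending energy *)

Section Splines.
Context {R : realType}.
Variables (a b : R) (s : seq R).
Hypotheses (ab : a < b) (ps : itv_partition a b s).
Local Notation mu := (@lebesgue_measure R).
Local Notation node := (node a b s).
Local Notation D1 := (D1 a b).
Local Notation vD1 := (vD1 a b).

Lemma D1D1_poly (f : R -> R) (p : {poly R}) i : (i < size s)%N ->
  (forall x, x \in `[node i, node i.+1] -> f x = p.[x]) ->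
  forall x, x \in `]node i, node i.+1[ -> D1 (D1 f) x = p^`()^`().[x].
Proof.
move=> si fp; have [ac db] := cell_sub ps si.
apply: D1_poly_open => //; apply: D1_poly_open => // x xi; apply: fp.
exact: subset_itv_oo_cc.
Qed.

Lemma off_nodes_poly_D1D1 (f : R -> R) : Vh a b s f ->
  off_nodes_poly a b s (D1 (D1 f)).
Proof.
move=> [_ fV] i si; have [p [_ fp]] := fV i si.
by exists p^`()^`(); exact: D1D1_poly.
Qed.

(** Linearity of the second derivative is available only inside the cells: at a
    node the inner derivatives need not be differentiable.  The polynomial used
    for w on a cell is the same combination of those of f and g. *)
Lemma D1D1_linear (f g w : R -> R) (c : R) : Vh a b s f -> Vh a b s g ->
  (forall x, x \in `[a, b] -> w x = f x + c * g x) ->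
  forall i x, (i < size s)%N -> x \in `]node i, node i.+1[ ->
  D1 (D1 w) x = D1 (D1 f) x + c * D1 (D1 g) x.
Proof.
move=> [_ fV] [_ gV] wE i x si xi.
have [p [_ fp]] := fV i si; have [q [_ gq]] := gV i si.
have [ac db] := cell_sub ps si.
rewrite (D1D1_poly si fp)// (D1D1_poly si gq)//.
rewrite (@D1D1_poly _ (p + c *: q) i)//.
  by rewrite !derivD !derivZ hornerD hornerZ.
move=> y yi; rewrite wE; first by rewrite fp// gq// hornerD hornerZ.
by move: yi; rewrite !in_itv/= => /andP[? ?]; apply/andP; split; lra.
Qed.

Definition bending (u : R -> 'cV[R]_3) : R := ip a b (vD1 (vD1 u)) (vD1 (vD1 u)).

Lemma off_nodes_poly_dot (u v : R -> 'cV[R]_3) :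
  (forall i, off_nodes_poly a b s (fun x => u x i 0)) ->
  (forall i, off_nodes_poly a b s (fun x => v x i 0)) ->
  off_nodes_poly a b s (fun x => dot (u x) (v x)).
Proof.
by move=> hu hv; apply: off_nodes_poly_sum => i; exact: off_nodes_polyM.
Qed.

Lemma vD1D1E (u : R -> 'cV[R]_3) x i :
  vD1 (vD1 u) x i 0 = D1 (D1 (fun y => u y i 0)) x.
Proof. by rewrite mxE; congr (D1 _ x); apply/funext => y; rewrite mxE. Qed.

Lemma off_nodes_poly_vD1D1 (u : R -> 'cV[R]_3) i : Vh3 a b s u ->
  off_nodes_poly a b s (fun x => vD1 (vD1 u) x i 0).
Proof.
move=> uV j sj; have [p pE] := off_nodes_poly_D1D1 (uV i) sj.
by exists p => x xj; rewrite vD1D1E pE.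
Qed.

(** The discrete product rule of the implicit Euler scheme; the last term is the
    numerical dissipation. *)
Lemma dot_step n (y d : 'cV[R]_n) (t : R) :
  dot (y + t *: d) (y + t *: d) =
  dot y y + 2 * t * dot (y + t *: d) d - t ^+ 2 * dot d d.
Proof. by rewrite !dotDl !dotDr !dotZl !dotZr (dotC d y); ring. Qed.

(** [dot_step] integrated, the dissipation term being dropped. *)
Lemma ip_step (U D W : R -> 'cV[R]_3) (t : R) :
  (forall i, off_nodes_poly a b s (fun x => U x i 0)) ->
  (forall i, off_nodes_poly a b s (fun x => D x i 0)) ->
  (forall i, off_nodes_poly a b s (fun x => W x i 0)) ->
  (forall i x, (i < size s)%N -> x \in `]node i, node i.+1[ ->
    W x = U x + t *: D x) ->
  ip a b W W <= ip a b U U + 2 * t * ip a b (fun x => U x + t *: D x) D.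
Proof.
move=> hU hD hW WE.
pose F x := dot (W x) (W x); pose H x := dot (U x) (U x).
pose J x := dot (U x + t *: D x) (D x); pose K x := dot (D x) (D x).
have hUD i : off_nodes_poly a b s (fun x => (U x + t *: D x) i 0).
  have := off_nodes_polyD (hU i)
    (off_nodes_polyM (@off_nodes_polyC R a b s t) (hD i)).
  by move=> h j sj; have [p pE] := h j sj; exists p => x xj; rewrite -pE// !mxE.
have hF : off_nodes_poly a b s F by exact: off_nodes_poly_dot.
have hH : off_nodes_poly a b s H by exact: off_nodes_poly_dot.
have hJ : off_nodes_poly a b s J by exact: off_nodes_poly_dot.
have hK : off_nodes_poly a b s K by exact: off_nodes_poly_dot.
have hcJ := off_nodes_polyM (@off_nodes_polyC R a b s (2 * t)) hJ.
have hcK := off_nodes_polyM (@off_nodes_polyC R a b s (- t ^+ 2)) hK.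
have hHJK := off_nodes_polyD (off_nodes_polyD hH hcJ) hcK.
have int Z : off_nodes_poly a b s Z -> mu.-integrable `[a, b] (EFin \o Z).
  exact: integrable_off_nodes.
have FE : \int[mu]_(x in `[a, b]) F x =
    \int[mu]_(x in `[a, b]) (H x + (2 * t) * J x + (- t ^+ 2) * K x).
  apply: (eq_integral_off_nodes ab ps hF hHJK) => i x si xi.
  by rewrite /F /H /J /K (WE _ _ si xi) dot_step/= mulNr.
have : 0 <= \int[mu]_(x in `[a, b]) K x.
  by apply: Rintegral_ge0 => x _; exact: dot_ge0.
rewrite /ip FE RintegralD//; [|exact: int (off_nodes_polyD hH hcJ)|exact: int].
rewrite RintegralD//; [|exact: int|exact: int].
rewrite !RintegralZl//; [|exact: int|exact: int].
move=> K0; rewrite gerDl mulNr oppr_le0.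
by rewrite mulr_ge0// sqr_ge0.
Qed.

Lemma bending_step (u d w : R -> 'cV[R]_3) (t : R) :
  Vh3 a b s u -> Vh3 a b s d -> Vh3 a b s w ->
  (forall x, x \in `[a, b] -> w x = u x + t *: d x) ->
  bending w <= bending u
    + 2 * t * ip a b (fun x => vD1 (vD1 u) x + t *: vD1 (vD1 d) x) (vD1 (vD1 d)).
Proof.
move=> uV dV wV wE.
apply: ip_step => [i|i|i|i x si xi]; try exact: off_nodes_poly_vD1D1.
apply/colP => j; rewrite [RHS]mxE [X in _ + X]mxE !vD1D1E.
apply: (D1D1_linear (uV j) (dV j) _ si xi) => y yab.
by rewrite wE// !mxE.
Qed.

End Splines.

(** * The essential supremum norm *)

Section SupremumNorm.
Context {R : realType}.
Variables a b : R.
Hypothesis ab : a < b.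
Local Notation mu := (@lebesgue_measure R).

(** On a space of measure zero the norm would be 0 by convention, so this is what
    gives the norm its meaning as an essential supremum. *)
Lemma mrestr_itv_gt0 : (0 < mrestr mu (measurable_itv `[a, b]) [set: R])%E.
Proof.
by rewrite /mrestr setTI lebesgue_measure_itv/= lte_fin ab -EFinB lte_fin subr_gt0.
Qed.

Lemma LinfnormP (f : R -> R) (M : \bar R) :
  reflect (\forall x \ae mrestr mu (measurable_itv `[a, b]), `|f x|%:E <= M)%E
    (Linfnorm a b f <= M)%E.
Proof.
rewrite /Linfnorm unlock mrestr_itv_gt0.
exact: ess_supP.
Qed.

Lemma Linfnorm_le (f : R -> R) (M : R) :
  (forall x, x \in `[a, b] -> `|f x| <= M) -> (Linfnorm a b f <= M%:E)%E.
Proof.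
move=> fM; apply/LinfnormP; exists (~` `[a, b]); split.
- exact: measurableC.
- by rewrite /mrestr/= setICl measure0.
- by move=> x /= h xab; apply: h; rewrite lee_fin fM.
Qed.

(** If |f| exceeded M at x, it would do so at all points of the interval close to
    x.  They include a nondegenerate interval, also when x is an endpoint, and
    this has positive measure. *)
Lemma le_Linfnorm (f : R -> R) (M : R) : {within `[a, b], continuous f} ->
  (Linfnorm a b f <= M%:E)%E -> forall x, x \in `[a, b] -> `|f x| <= M.
Proof.
move=> /subspace_continuousP fc /LinfnormP[N [mN N0 fN]] x xab.
rewrite leNgt; apply/negP => Mf.
have := fc x xab => /cvg_norm /cvgr_gt /(_ _ Mf).
rewrite near_withinE => -[e /= e0 he].
move: (xab); rewrite in_itv/= => /andP[ax xb].
pose c := Num.max a (x - e / 2); pose d := Num.min b (x + e / 2).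
have e20 : 0 < e / 2 by rewrite divr_gt0.
have cd : c < d.
  have xe1 : x - e / 2 < x by lra.
  have xe2 : x < x + e / 2 by lra.
  rewrite gt_max !lt_min ab (lt_trans xe1 xe2) (le_lt_trans ax xe2).
  by rewrite (lt_le_trans xe1 xb).
have cdN : `[c, d]%classic `<=` N `&` `[a, b].
  move=> y /=; rewrite !in_itv/= ge_max le_min.
  move=> /andP[/andP[ay xy] /andP[yb yx]].
  split; last by rewrite ay yb.
  apply: fN => /=; rewrite lee_fin; apply/negP; rewrite -ltNge.
  apply: he; last by rewrite in_itv/= ay yb.
  by rewrite /ball_/= ltr_norml; apply/andP; split; lra.
have : (mu `[c, d] <= mu (N `&` `[a, b]))%E.
  by apply: le_measure => //; rewrite inE//; exact: measurableI.
move: N0; rewrite /mrestr => ->.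
by rewrite lebesgue_measure_itv/= lte_fin cd -EFinB lee_fin subr_le0 leNgt cd.
Qed.

End SupremumNorm.

(** * Regularity of splines *)

Section SplineSpace.
Context {R : realType}.
Variables (a b : R) (s : seq R).
Hypotheses (ab : a < b) (ps : itv_partition a b s).
Local Notation mu := (@lebesgue_measure R).
Local Notation vD1 := (vD1 a b).

Lemma Vh3_L2vec (v : R -> 'cV[R]_3) : Vh3 a b s v -> L2vec a b v.
Proof.
move=> vV i; have [[dv _] _] := vV i.
have cv := derivableI_continuous ab dv.
split; first exact: subspace_continuous_measurable_fun.
apply: continuous_compact_integrable; first exact: segment_compact.
by move=> x; apply: cvgM; exact: cv.
Qed.

Lemma continuous_enorm_vD1 (v : R -> 'cV[R]_3) : Vh3 a b s v ->
  {within `[a, b], continuous (fun x => enorm (vD1 v x))}.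
Proof.
move=> vV x.
have cd : {for x, continuous ((fun y => dot (vD1 v y) (vD1 v y)) :
    subspace `[a, b] -> R)}.
  apply: cvg_big => [|i _]; first exact: add_continuous.
  have [[_ cv] _] := vV i.
  under eq_cvg do rewrite !mxE.
  by rewrite !mxE; apply: cvgM; exact: cv.
exact: (@cvg_comp _ _ _ _ (@Num.sqrt R) _ _ _ cd (@sqrt_continuous R _)).
Qed.

Lemma vD1_linear (u d w : R -> 'cV[R]_3) (t : R) :
  Vh3 a b s u -> Vh3 a b s d ->
  (forall x, x \in `[a, b] -> w x = u x + t *: d x) ->
  forall x, x \in `[a, b] -> vD1 w x = vD1 u x + t *: vD1 d x.
Proof.
move=> uV dV wE x xab; apply/colP => i; rewrite !mxE.
have [[du _] _] := uV i; have [[dd _] _] := dV i.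
apply: D1_linear => //; [|exact: du|exact: dd].
by move=> y yab; rewrite wE// !mxE.
Qed.

End SplineSpace.

(** * The energy and its decrease in one step *)

Section Energy.
Context {R : realType}.
Variables (a b : R) (s : seq R).
Hypotheses (ab : a < b) (ps : itv_partition a b s).
Variables (m : nat) (G : 'I_m -> 'M[R]_3).
Hypothesis GP : forall r, sym_psd (G r).
Variables (kappa eps : R).
Hypotheses (kappa0 : 0 < kappa) (eps0 : 0 < eps).
Local Notation mu := (@lebesgue_measure R).
Local Notation vD1 := (vD1 a b).
Local Notation energy := (energy a b s G kappa eps).

Lemma energyE (u : R -> 'cV[R]_3) :
  energy u = kappa / 2 * bending a b u +
    (2 * eps)^-1 * lumped a b s (fun y => dot (u y) (Gtot G *m u y) + Vcv G (u y)).
Proof.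
congr (_ * _ + _); apply: eq_Rintegral => x _; exact: sqr_enorm.
Qed.

Lemma energy_ge0 (u : R -> 'cV[R]_3) : 0 <= energy u.
Proof.
rewrite energyE addr_ge0 ?mulr_ge0 ?invr_ge0 ?mulr_ge0 ?(ltW kappa0) ?(ltW eps0)//.
  by apply: Rintegral_ge0 => x _; exact: dot_ge0.
by apply: lumped_ge0 => // i _; exact: confinement_ge0.
Qed.

(** The hypothesis on N is the scheme tested with d, N standing for the star product
    of d with itself.  The bending and potential increments are at most t times the
    terms of that identity, and these add up to - t * N. *)
Lemma energy_step (u d w : R -> 'cV[R]_3) (t N : R) :
  Vh3 a b s u -> Vh3 a b s d -> Vh3 a b s w ->
  0 < t ->
  (forall x, x \in `[a, b] -> w x = u x + t *: d x) ->
  N + kappa * ip a b (fun x => vD1 (vD1 u) x + t *: vD1 (vD1 d) x) (vD1 (vD1 d))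
    + eps^-1 * iph a b s (fun x => u x + t *: d x) (fun x => Gtot G *m d x)
  = - (2 * eps)^-1 * iph a b s (fun x => gradient (Vcv G) (u x)) d ->
  energy w + t * N <= energy u.
Proof.
move=> uV dV wV t0 wE weak.
have bend := bending_step ab ps uV dV wV wE.
pose Phi (y : 'cV[R]_3) := dot y (Gtot G *m y) + Vcv G y.
pose J := iph a b s (fun x => u x + t *: d x) (fun x => Gtot G *m d x).
pose H := iph a b s (fun x => gradient (Vcv G) (u x)) d.
have pot : lumped a b s (fun y => Phi (w y)) <=
    lumped a b s (fun y => Phi (u y)) + 2 * t * J + t * H.
  rewrite /J /H /iph -/(lumped _ _ _ _) -/(lumped _ _ _ _) -!lumped_linear//.
  apply: lumped_le => // i si; rewrite wE; last exact: node_in_itv.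
  exact: confinement_step.
rewrite !energyE -/Phi.
move: weak bend pot; rewrite -/J -/H.
set B := ip _ _ _ _; set bu := bending _ _ u; set bw := bending _ _ w.
set pw := lumped _ _ _ _; set pu := lumped _ _ _ _ => weak bend pot.
clearbody B bu bw pu pw J H.
have bend' : kappa / 2 * bw <= kappa / 2 * (bu + 2 * t * B).
  by rewrite ler_wpM2l// divr_ge0// ltW.
have pot' : (2 * eps)^-1 * pw <= (2 * eps)^-1 * (pu + 2 * t * J + t * H).
  by rewrite ler_wpM2l// invr_ge0 mulr_ge0// ltW.
apply: le_trans (_ : kappa / 2 * (bu + 2 * t * B)
  + (2 * eps)^-1 * (pu + 2 * t * J + t * H) + t * N <= _); first by lra.
have -> : N = - (2 * eps)^-1 * H - kappa * B - eps^-1 * J by lra.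
rewrite le_eqVlt; apply/orP; left; apply/eqP; field.
by rewrite gt_eqF.
Qed.

End Energy.

(** * Summation over the steps *)

Lemma sum_dissipation (R : realType) (E N : nat -> R) (t : R) :
  (forall k, E k.+1 + t * N k <= E k) ->
  forall K, E K + t * \sum_(0 <= k < K) N k <= E 0%N.
Proof.
move=> step; elim=> [|K IH]; first by rewrite big_nil mulr0 addr0.
by rewrite big_nat_recr//= mulrDr; have := step K; lra.
Qed.

Lemma sum_growth (R : realType) (q g N : nat -> R) (t c : R) :
  0 <= t -> (forall k, q k.+1 = q k + t * g k) ->
  (forall k, 0 <= g k <= c * N k) ->
  forall K, q 0%N <= q K <= q 0%N + t * c * \sum_(0 <= k < K) N k.
Proof.
move=> t0 qS gN; elim=> [|K /andP[lo up]].
  by rewrite big_nil mulr0 addr0 lexx.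
rewrite big_nat_recr//= qS; have /andP[g0 gc] := gN K.
have := ler_wpM2l t0 gc; have := mulr_ge0 t0 g0 => h1 h2.
by apply/andP; split; lra.
Qed.

Theorem proposition2p6 (R : realType)
  (a b : R) (s : seq R) (h : R)
  (ab : a < b) (ps : itv_partition a b s) (hE : h = mesh a b s)
  (star : (R -> 'cV[R]_3) -> (R -> 'cV[R]_3) -> R)
  (starP : L2_inner_product a b star)
  (m : nat) (m0 : (0 < m)%N) (G : 'I_m -> 'M[R]_3)
  (GP : forall r, sym_psd (G r))
  (l : nat) (L : (R -> 'cV[R]_3) -> 'cV[R]_l) (lbc : 'cV[R]_l)
  (LP : bounded_linear_H2 a b L)
  (kappa eps tau : R)
  (kappa0 : 0 < kappa) (eps0 : 0 < eps) (h0 : 0 < h) (tau0 : 0 < tau)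
  (u dtu : nat -> R -> 'cV[R]_3)
  (u0 : Ah a b s L lbc (u 0%N))
  (uV : forall k, Vh3 a b s (u k))
  (uS : forall k x, x \in `[a, b] -> u k.+1 x = u k x + tau *: dtu k.+1 x)
  (dtuF : forall k, Fh a b s L (u k) (dtu k.+1))
  (dtuE : forall k v, Fh a b s L (u k) v ->
     star (dtu k.+1) v
     + kappa * ip a b
         (fun x => vD1 a b (vD1 a b (u k)) x
                   + tau *: vD1 a b (vD1 a b (dtu k.+1)) x)
         (vD1 a b (vD1 a b v))
     + eps^-1 * iph a b s (fun x => u k x + tau *: dtu k.+1 x)
                          (fun x => Gtot G *m v x)
     = - (2 * eps)^-1 * iph a b s (fun x => gradient (Vcv G) (u k x)) v) :
  (forall K : nat,
     energy a b s G kappa eps (u K)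
     + tau * \sum_(0 <= k < K) star_norm star (dtu k.+1) ^+ 2
     <= energy a b s G kappa eps (u 0%N)) /\
  (forall cstar : R,
     (forall v, Vh3 a b s v ->
        (Linfnorm a b (fun x => enorm (vD1 a b v x))%R
         <= (cstar * star_norm star v)%R%:E)%E) ->
     forall K : nat,
     (Linfnorm a b
        (fun x => interp a b s (fun y => enorm (vD1 a b (u K) y) ^+ 2) x - 1)%R
      <= (cstar ^+ 2 * tau * energy a b s G kappa eps (u 0%N))%R%:E)%E).
Proof.
have stepE k : energy a b s G kappa eps (u k.+1)
    + tau * star_norm star (dtu k.+1) ^+ 2 <= energy a b s G kappa eps (u k).
  have [dV _ _] := dtuF k.
  apply: (energy_step ab ps GP kappa0 eps0 (uV k) dV (uV k.+1) tau0 (uS k)).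
  (* Positivity of star on splines makes the square of star_norm equal to star. *)
  rewrite sqr_sqrtr; last exact: (star_ge0 starP (Vh3_L2vec ab dV)).
  exact: dtuE (dtuF k).
have dissipation K : energy a b s G kappa eps (u K)
    + tau * \sum_(0 <= k < K) star_norm star (dtu k.+1) ^+ 2
    <= energy a b s G kappa eps (u 0%N).
  exact: (sum_dissipation (E := fun k => energy a b s G kappa eps (u k))).
split=> // cstar star_emb K.
pose n2 k x := enorm (vD1 a b (u k) x) ^+ 2.
(* Pythagoras at the nodes. *)
have nodeE k i : (i <= size s)%N -> n2 k.+1 (node a b s i) =
    n2 k (node a b s i) + tau ^+ 2 * enorm (vD1 a b (dtu k.+1) (node a b s i)) ^+ 2.
  move=> si; have [dV orth _] := dtuF k.
  rewrite /n2 (vD1_linear ab (uV k) dV (uS k)); last exact: node_in_itv.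
  rewrite !sqr_enorm dotDl !dotDr !dotZl !dotZr (dotC (vD1 a b (dtu _) _)).
  by rewrite orth//; ring.
pose S := \sum_(0 <= k < K) star_norm star (dtu k.+1) ^+ 2.
have node1 i : (i <= size s)%N ->
    1 <= n2 K (node a b s i) <= 1 + tau ^+ 2 * cstar ^+ 2 * S.
  move=> si; have [_ u01 _] := u0; rewrite -(u01 i si).
  apply: (sum_growth (q := n2 ^~ (node a b s i)) (sqr_ge0 tau)) => k.
    exact: nodeE.
  have [dV _ _] := dtuF k; rewrite sqr_ge0 -exprMn/=.
  have := le_Linfnorm ab (continuous_enorm_vD1 dV) (star_emb _ dV)
    (node_in_itv ps si).
  rewrite ger0_norm ?sqrtr_ge0// => le1.
  by rewrite lerXn2r// nnegrE ?(le_trans _ le1) ?sqrtr_ge0.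
have S0 : 0 <= S by apply: sumr_ge0 => k _; exact: sqr_ge0.
have SE : tau * S <= energy a b s G kappa eps (u 0%N).
  apply: le_trans (dissipation K); rewrite lerDr.
  exact: energy_ge0.
apply: Linfnorm_le => // x xab.
apply: (@le_trans _ _ (tau ^+ 2 * cstar ^+ 2 * S)); last first.
  rewrite (_ : _ * S = cstar ^+ 2 * tau * (tau * S)); last by ring.
  by rewrite ler_wpM2l// mulr_ge0 ?sqr_ge0// ltW.
have up : interp a b s (n2 K) x <= 1 + tau ^+ 2 * cstar ^+ 2 * S.
  rewrite -[leRHS](interp_cst a b s _ x).
  by apply: interp_le => // i si; have /andP[] := node1 i si.
have lo : 1 <= interp a b s (n2 K) x.
  rewrite -[leLHS](interp_cst a b s 1 x).
  by apply: interp_le => // i si; have /andP[] := node1 i si.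
rewrite ger0_norm ?subr_ge0// lerBlDl; exact: up.
Qed.
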